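(* Every (nonzero) locally uniformly convex Banach space is USD-nonfriendly with USD-parameter $2$. In particular, the spaces $L_p(\mu)$ are USD-nonfriendly for $1<p<\infty$.
   Context: Banach spaces are real. $B(E)$ is the closed unit ball and $S(E)$ the unit sphere of a Banach space $E$. A Banach space $E$ is locally uniformly convex if every $x_0\in S(E)$ has the property that $x_n\to x_0$ whenever $\|x_n\|\le 1$ and $\|x_n+x_0\|\to 2$. For $x,y\in E$ and $\varepsilon>0$ put $D(x,y,\varepsilon)=\{z\in E:\|x+y+z\|>2-\varepsilon,\ \|y+z\|<1+\varepsilon\}$ and $\mathcal{D}(E)=\{D(x,y,\varepsilon): x,y\in S(E),\ \varepsilon>0\}$. A Banach space $E$ is USD-nonfriendly if there exists $\alpha>0$ such that every closed absolutely convex (i.e. nonempty, convex and balanced) subset $A\subset E$ which intersects every element of $\mathcal{D}(E)$ contains $\alpha B(E)$. The largest admissible $\alpha$ is called the USD-parameter of $E$. *)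

(* Defs.v *)
From HB Require Import structures.
From mathcomp Require Import all_boot all_order all_algebra.
From mathcomp Require Import all_classical all_reals all_analysis.
From mathcomp Require Import measurable_realfun ess_sup_inf lra.

Set Implicit Arguments.
Unset Strict Implicit.
Unset Printing Implicit Defensive.

Import Order.TTheory GRing.Theory Num.Theory.
Import numFieldNormedType.Exports.

Local Open Scope classical_set_scope.
Local Open Scope ring_scope.

Section USD_nonfriendly_spaces.
Context (R : realType).
Implicit Type E : completeNormedModType R.

Definition unit_ball E : set E := [set x | `|x| <= 1].

Definition unit_sphere E : set E := [set x | `|x| = 1].

Definition locally_uniformly_convex E : Prop :=
  forall x0 : E, unit_sphere x0 ->
  forall x : nat -> E, (forall n, `|x n| <= 1) ->
    `|x n + x0| @[n --> \oo] --> (2 : R) ->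
    x n @[n --> \oo] --> x0.

Definition Dset E (x y : E) (eps : R) : set E :=
  [set z | 2 - eps < `|x + y + z| /\ `|y + z| < 1 + eps].

Definition Dfamily E : set (set E) :=
  [set D | exists x y : E, exists eps : R,
    [/\ unit_sphere x, unit_sphere y, 0 < eps & D = Dset x y eps]].

Definition balanced E (A : set E) : Prop :=
  forall (a : R) (x : E), `|a| <= 1 -> A x -> A (a *: x).

Definition absolutely_convex E (A : set E) : Prop :=
  [/\ A !=set0, convex_set (A : set (convex_lmodType E)) & balanced A].

Definition USD_admissible E (alpha : R) : Prop :=
  0 < alpha /\
  forall A : set E, closed A -> absolutely_convex A ->
    (forall D, Dfamily D -> A `&` D !=set0) ->
    [set alpha *: z | z in @unit_ball E] `<=` A.

Definition USD_nonfriendly E : Prop := exists alpha, USD_admissible E alpha.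

Definition is_USD_parameter E (alpha : R) : Prop :=
  USD_admissible E alpha /\
  forall beta, USD_admissible E beta -> beta <= alpha.

End USD_nonfriendly_spaces.

(* The library provides L^p(mu) as the bare type [LspaceType mu p1] of classes
   of measurable functions of finite L^p-norm modulo a.e. equality, without
   any algebraic structure. We equip it with the operations induced by those
   of functions and with the norm [fine 'N[mu]_p[EFin \o f]], and show that
   it is complete for finite p. *)
Section Lspace_structure.
Context d (T : measurableType d) (R : realType).
Variable mu : {measure set T -> \bar R}.
Variables (p : \bar R) (p1 : (1 <= p)%E).
Local Notation fT := (LfunType mu p1).
Local Notation LT := (LspaceType mu p1).
Local Notation qT := ({mfun_ mu, T >-> measurableTypeR R}).

Lemma Lnorm_ae_eq (f g : {mfun T >-> R}) : f = g %[ae mu] ->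
  'N[mu]_p[EFin \o f]%E = 'N[mu]_p[EFin \o g]%E.
Proof.
move=> fg; case: p p1 => [r r1|_|//]; rewrite unlock /Lnorm.
- have mp (h : T -> \bar R) : measurable_fun [set: T] h ->
      measurable_fun [set: T] (fun x => `|h x| `^ r)%E.
    move=> mh; apply: (measurableT_comp (measurable_poweR _)).
    exact: measurableT_comp.
  congr (_ `^ _)%E; apply: ae_eq_integral; [exact: measurableT| | |].
  + by apply: mp; exact: measurableT_comp.
  + by apply: mp; exact: measurableT_comp.
  + by apply: filterS fg => x /= + Dx => /(_ Dx) ->.
- case: ifP => // _; apply: eq_ess_sup.
  by apply: filterS fg => x /= /(_ I) ->.
Qed.

Lemma Lspace_repr_Lfun (f : LT) :
  ((f : qT) : T -> R) \in Lfun mu p.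
Proof.
apply/andP; split; rewrite inE /=.
  exact: (@measurable_funPT _ _ _ _ (repr (f : qT))).
exact: (@Lebesgue_finite _ _ _ _ _ _ f).
Qed.

Definition Lrepr (f : LT) : fT := Lfun_Sub p1 (Lspace_repr_Lfun f).

(* [LspaceType] classifies functions into [measurableTypeR R], whose
   [measurableType] structure is not syntactically the canonical one of [R],
   although their measurable sets coincide. *)
Lemma Lfun_measurableTypeR (f : fT) :
  @measurable_fun _ _ T (measurableTypeR R) setT f.
Proof. exact: (@measurable_funPT _ _ _ _ f). Qed.

Definition mfun_of_Lfun (f : fT) : {mfun T >-> measurableTypeR R} :=
  HB.pack (f : T -> measurableTypeR R)
    (isMeasurableFun.Build _ _ _ _ _ (Lfun_measurableTypeR f)).

Definition Lcls (f : fT) : qT := (\pi_qT (mfun_of_Lfun f))%qT.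

Lemma Lcls_repr (f : fT) : (Lcls f : T -> R) = f %[ae mu].
Proof.
have : ae_eq_op mu (repr (Lcls f)) (mfun_of_Lfun f).
  by rewrite -eqmodE reprK.
by move=> /asboolP.
Qed.

Lemma Lclass_subproof (f : fT) : finite_norm mu p (Lcls f).
Proof.
rewrite /finite_norm.
have mf : (Lcls f : T -> R) \in mfun.
  by rewrite inE; exact: (@measurable_funPT _ _ _ _ (repr (Lcls f))).
have := @Lnorm_ae_eq (mfun_Sub mf) f (Lcls_repr f).
by move=> /= ->; exact: Lfunction_finite.
Qed.

Definition Lclass (f : fT) : LT :=
  LebesgueSpace.Pack (LebesgueSpace.Class (isFinLebesgue.Build d T R mu p p1
    (Lcls f) (Lclass_subproof f))).

Lemma LclassK (f : fT) : Lrepr (Lclass f) = f %[ae mu].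
Proof. exact: Lcls_repr. Qed.

Lemma Lspace_inj (f g : LT) : (f : qT) = g -> f = g.
Proof.
case: f g => [f [[f0]]] [g [[g0]]] /= fg; case: _ / fg in g0 *.
by rewrite (Prop_irrelevance f0 g0).
Qed.

Lemma Lclass_eq (f g : fT) : f = g %[ae mu] -> Lclass f = Lclass g.
Proof.
move=> fg; apply: Lspace_inj => /=; apply/eqmodP.
exact/asboolP.
Qed.

Lemma LreprK : cancel Lrepr Lclass.
Proof.
move=> f; apply: Lspace_inj => /=; rewrite -[RHS]reprK; apply/eqmodP.
by apply/asboolP; exact: ae_eq_refl.
Qed.


HB.instance Definition _ := gen_eqMixin LT.
HB.instance Definition _ := gen_choiceMixin LT.

Let Ladd (f g : LT) : LT := Lclass (Lrepr f + Lrepr g).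
Let Lopp (f : LT) : LT := Lclass (- Lrepr f).
Let Lscale (a : R) (f : LT) : LT := Lclass (a *: Lrepr f).

Let LaddE (f g : fT) : Ladd (Lclass f) (Lclass g) = Lclass (f + g).
Proof.
apply: Lclass_eq; have := LclassK f; have := LclassK g.
by apply: filterS2 => x g' f' Dx; exact: (congr2 +%R (f' Dx) (g' Dx)).
Qed.

Let LoppE (f : fT) : Lopp (Lclass f) = Lclass (- f).
Proof.
apply: Lclass_eq; have := LclassK f.
by apply: filterS => x f' Dx; exact: (congr1 -%R (f' Dx)).
Qed.

Let LscaleE a (f : fT) : Lscale a (Lclass f) = Lclass (a *: f).
Proof.
apply: Lclass_eq; have := LclassK f.
by apply: filterS => x f' Dx; exact: (congr1 ( *%R a) (f' Dx)).
Qed.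

Let LaddA : associative Ladd.
Proof.
move=> f g h; rewrite -(LreprK f) -(LreprK g) -(LreprK h) !LaddE.
by rewrite addrA.
Qed.

Let LaddC : commutative Ladd.
Proof. by move=> f g; rewrite /Ladd addrC. Qed.

Let Ladd0 : left_id (Lclass 0) Ladd.
Proof. by move=> f; rewrite -(LreprK f) LaddE add0r. Qed.

Let LaddN : left_inverse (Lclass 0) Lopp Ladd.
Proof. by move=> f; rewrite -(LreprK f) LoppE LaddE addNr. Qed.

HB.instance Definition _ := GRing.isZmodule.Build LT LaddA LaddC Ladd0 LaddN.

Let LscaleA a b (f : LT) : Lscale a (Lscale b f) = Lscale (a * b) f.
Proof. by rewrite -(LreprK f) !LscaleE scalerA. Qed.

Let Lscale1 : left_id 1 Lscale.
Proof. by move=> f; rewrite -(LreprK f) LscaleE scale1r. Qed.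

Let LscaleDr : right_distributive Lscale +%R.
Proof.
move=> a f g; rewrite -(LreprK f) -(LreprK g) ![_ + _]LaddE !LscaleE.
by rewrite [RHS]LaddE scalerDr.
Qed.

Let LscaleDl (f : LT) : {morph Lscale^~ f : a b / a + b}.
Proof.
move=> a b; rewrite -(LreprK f) !LscaleE.
by rewrite [RHS]LaddE scalerDl.
Qed.

HB.instance Definition _ :=
  GRing.Zmodule_isLmodule.Build R LT LscaleA Lscale1 LscaleDr LscaleDl.

Lemma LclassD (f g : fT) : Lclass (f + g) = Lclass f + Lclass g.
Proof. by rewrite -LaddE. Qed.

Lemma LclassN (f : fT) : Lclass (- f) = - Lclass f.
Proof. by rewrite -LoppE. Qed.

Lemma LclassZ a (f : fT) : Lclass (a *: f) = a *: Lclass f.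
Proof. by rewrite -LscaleE. Qed.

Definition Lspace_norm (f : LT) : R := fine 'N[mu]_p[EFin \o (f : qT)]%E.

Lemma Lspace_normE (f : fT) :
  Lspace_norm (Lclass f) = fine 'N[mu]_p[EFin \o f]%E.
Proof.
congr fine.
exact: (@Lnorm_ae_eq (Lrepr (Lclass f)) f (LclassK f)).
Qed.

Let Lspace_normD (f g : LT) :
  Lspace_norm (f + g) <= Lspace_norm f + Lspace_norm g.
Proof.
rewrite -(LreprK f) -(LreprK g) -LclassD !Lspace_normE.
exact: ler_LnormD.
Qed.

Let Lspace_normZ a (f : LT) : Lspace_norm (a *: f) = `|a| * Lspace_norm f.
Proof.
rewrite -(LreprK f) -LclassZ !Lspace_normE; apply: EFin_inj.
by rewrite EFinM !finite_norm_fine -LnormZ.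
Qed.

Let Lspace_norm_eq0 (f : LT) : Lspace_norm f = 0 -> f = 0.
Proof.
rewrite -(LreprK f) Lspace_normE => /fine_Lnormr_eq0 f0.
exact: Lclass_eq.
Qed.

HB.instance Definition _ := Lmodule_isNormed.Build R LT
  Lspace_normD Lspace_normZ Lspace_norm_eq0.

End Lspace_structure.

Section Lspace_complete.
Context d (T : measurableType d) (R : realType).
Variable mu : {measure set T -> \bar R}.
Variables (r : R) (r1 : (1 <= r%:E)%E).
Local Notation fT := (LfunType mu r1).
Local Notation LT := (LspaceType mu r1).

Let r_ge1 : 1 <= r. Proof. by rewrite -lee_fin. Qed.
Let r_gt0 : 0 < r. Proof. exact: lt_le_trans ltr01 r_ge1. Qed.

Let measurable_powE (h : T -> R) : measurable_fun [set: T] h ->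
  measurable_fun [set: T] (fun x => `|(h x)%:E| `^ r)%E.
Proof.
move=> mh; apply: (measurableT_comp (measurable_poweR _)).
by apply: measurableT_comp => //; exact: measurableT_comp.
Qed.

Let limn_einf_le (u : (\bar R)^nat) (c : \bar R) (N : nat) :
  (forall m, (N <= m)%N -> (u m <= c)%E) -> (limn_einf u <= c)%E.
Proof.
move=> uc; rewrite limn_einf_lim; apply: lime_le; first exact: is_cvg_einfs.
apply: nearW => k; apply: (@le_trans _ _ (u (maxn k N))).
  by apply: ereal_inf_lbound => /=; exists (maxn k N) => //=; exact: leq_maxl.
by apply: uc; exact: leq_maxr.
Qed.

Let limn_einf_ge0 (u : (\bar R)^nat) :
  (forall n, 0 <= u n)%E -> (0 <= limn_einf u)%E.
Proof.
move=> u0; rewrite limn_einf_lim; apply: lime_ge; first exact: is_cvg_einfs.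
by apply: nearW => k; apply: le_ereal_inf_tmp => _ [n _ <-].
Qed.

Let powR_continuous (a : R) : 0 < a -> {for a, continuous (fun t : R => t `^ r)}.
Proof.
move=> a0; apply/differentiable_continuous/derivable1_diffP.
by have [] := is_derive1_powR r a0.
Qed.

Let Lfun_ae_cvg (f : nat -> fT) :
  (forall k, fine 'N[mu]_r%:E[EFin \o (f k.+1 - f k)%R]%E <= 4^-1 ^+ k) ->
  {ae mu, forall x, cvgn (f^~ x)}.
Proof.
move=> f_small.
pose D k : fT := 2 ^+ k *: (f k.+1 - f k).
pose h k x := (`|(D k x)%:E| `^ r)%E.
have mD k : measurable_fun [set: T] (D k) by exact: measurable_funPT.
have mh k : measurable_fun [set: T] (h k) by apply: measurable_powE.
have h0 k x : [set: T] x -> (0 <= h k x)%E by move=> _; exact: poweR_ge0.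
have intD k : (\int[mu]_x h k x <= (2 / (2 ^ k.+1)%:R)%:E)%E.
  rewrite -(@powR_Lnorm _ _ _ mu (EFin \o D k)) ?gt_eqF//.
  rewrite -finite_norm_fine poweR_EFin lee_fin.
  have -> : 2 / (2 ^ k.+1)%:R = 2^-1 ^+ k :> R.
    by rewrite natrX exprS invfM mulrA divff // mul1r exprVn.
  have nD : fine 'N[mu]_r%:E[EFin \o D k]%E <= 2^-1 ^+ k.
    rewrite -lee_fin finite_norm_fine /D.
    rewrite (LnormZ (f k.+1 - f k)%R) -finite_norm_fine -EFinM lee_fin.
    rewrite ger0_norm ?exprn_ge0//.
    apply: (le_trans (ler_wpM2l _ (f_small k))); first exact: exprn_ge0.
    by rewrite -exprMn; apply: lerXn2r; rewrite ?nnegrE; lra.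
  have nD0 : 0 <= fine 'N[mu]_r%:E[EFin \o D k]%E.
    by rewrite fine_ge0 // Lnorm_ge0.
  apply: (le_trans (ge0_ler_powR (ltW r_gt0) _ _ nD)).
  - by rewrite nnegrE.
  - by rewrite nnegrE exprn_ge0.
  - apply: ge1r_powR => //; rewrite exprn_gt0//= exprn_ile1//; lra.
pose H x := (\sum_(0 <= k <oo) h k x)%E.
have H0 x : (0 <= H x)%E by apply: nneseries_ge0 => k _ _; exact: h0.
have mH : measurable_fun [set: T] H.
  by apply: (ge0_emeasurable_sum (P := xpredT)) => // k x Dx _; exact: h0.
have intH : mu.-integrable [set: T] H.
  apply/integrableP; split => //.
  under eq_integral do rewrite gee0_abs//.
  rewrite integral_nneseries//.
  apply: (@le_lt_trans _ _ 2%:E); last exact: ltry.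
  apply: le_trans (@epsilon_trick0 R 2 xpredT _) => //.
  by apply: lee_nneseries => // k _ _; apply: integral_ge0 => x Dx; exact: h0.
have := integrable_ae measurableT intH; apply: filterS => x /(_ I) Hx.
pose C := fine (H x) `^ r^-1.
have DC k : `|D k x| <= C.
  have hH : (h k x <= H x)%E.
    apply: (@le_trans _ _ (\sum_(0 <= i < k.+1) h i x)%E).
      by rewrite big_nat_recr//= leeDr//; apply: sume_ge0 => *; exact: h0.
    by apply: nneseries_lim_ge => *; exact: h0.
  move: hH; rewrite /h abse_EFin poweR_EFin -[X in (_ <= X)%E]fineK// lee_fin.
  have rV0 : 0 <= r^-1 by rewrite invr_ge0 ltW.
  move=> /(ge0_ler_powR rV0); rewrite !nnegrE powR_ge0 fine_ge0//.
  by move=> /(_ isT isT); rewrite -powRrM divff ?gt_eqF// powRr1.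
suff : cvgn (series (telescope (f^~ x))).
  move=> cs; rewrite (_ : f^~ x = (fun n => f 0%N x + series (telescope (f^~ x)) n)).
    by apply: is_cvgD => //; exact: is_cvg_cst.
  by apply/funext => n; exact: eq_sum_telescope.
apply: normed_cvg.
apply: (@series_le_cvg _ _ (geometric C 2^-1)) => [k|k|k|].
- exact: normr_ge0.
- by rewrite /geometric/= mulr_ge0// ?powR_ge0// exprn_ge0.
- rewrite /geometric/= /telescope.
  have := DC k; rewrite (_ : D k x = 2 ^+ k * (f k.+1 x - f k x))//.
  rewrite normrM ger0_norm ?exprn_ge0//.
  by rewrite exprVn ler_pdivlMr ?exprn_gt0// mulrC.
- by apply: is_cvg_geometric_series; rewrite ger0_norm//; lra.
Qed.

Let Lfun_cauchy_limit (f : nat -> fT) :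
  (forall m n, (m <= n)%N ->
    fine 'N[mu]_r%:E[EFin \o (f n - f m)%R]%E <= 4^-1 ^+ m) ->
  exists g : fT, forall m,
    fine 'N[mu]_r%:E[EFin \o (g - f m)%R]%E <= 4^-1 ^+ m.
Proof.
move=> f_cauchy.
have /Lfun_ae_cvg cf k : fine 'N[mu]_r%:E[EFin \o (f k.+1 - f k)%R]%E <= 4^-1 ^+ k.
  by apply: f_cauchy.
pose g x := fine (limn_esup (fun n => (f n x)%:E)).
have mf n : measurable_fun [set: T] (f n) by exact: measurable_funPT.
have mg : measurable_fun [set: T] g.
  apply: measurableT_comp => //; apply: measurable_fun_limn_esup => n.
  exact: measurableT_comp.
have fg : {ae mu, forall x, f n x @[n --> \oo] --> g x}.
  move: cf; apply: filterS => x cx; rewrite /g.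
  have /cvg_limn_einf_sup[_ ->] :
      (f n x)%:E @[n --> \oo] --> (limn (f^~ x))%:E.
    by apply: cvg_EFin => //; exact: nearW.
  by [].
have g_close m : ('N[mu]_r%:E[EFin \o (g - f m)%R] <= (4^-1 ^+ m)%:E)%E.
  have c0 : 0 <= 4^-1 ^+ m :> R by rewrite exprn_ge0.
  rewrite unlock /Lnorm.
  have -> : (4^-1 ^+ m)%:E = ((4^-1 ^+ m)%:E `^ r `^ r^-1)%E :> \bar R.
    by rewrite !poweR_EFin -powRrM divff ?gt_eqF// powRr1.
  apply: gt0_ler_poweR.
  - by rewrite invr_ge0 ltW.
  - by rewrite in_itv/= leey andbT integral_ge0// => x _; exact: poweR_ge0.
  - by rewrite in_itv/= leey andbT lee_fin powR_ge0.
  have mgf : measurable_fun [set: T] (fun x => `|(g x - f m x)%:E| `^ r)%E.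
    by apply: measurable_powE; exact: measurable_funB.
  have mff n : measurable_fun [set: T] (fun x => `|(f n x - f m x)%:E| `^ r)%E.
    by apply: measurable_powE; exact: measurable_funB.
  have mL : measurable_fun [set: T]
      (fun x => limn_einf (fun n => `|(f n x - f m x)%:E| `^ r))%E.
    apply: (eq_measurable_fun
        (fun x => - limn_esup (fun n => - (`|(f n x - f m x)%:E| `^ r)))%E).
      move=> x _; rewrite -limn_einfN; congr limn_einf; apply/funext => n.
      by rewrite /comp oppeK.
    apply: measurableT_comp => //; apply: measurable_fun_limn_esup => n.
    exact: measurableT_comp.
  have h0 n x : (0 <= `|(f n x - f m x)%:E| `^ r)%E by exact: poweR_ge0.
  change (\int[mu]_x (`|(g x - f m x)%:E| `^ r) <= (4^-1 ^+ m)%:E `^ r)%E.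
  apply: (@le_trans _ _
      (\int[mu]_x limn_einf (fun n => `|(f n x - f m x)%:E| `^ r))%E).
    apply: ae_ge0_le_integral => //.
    - by move=> x _; exact: poweR_ge0.
    - by move=> x _; exact: limn_einf_ge0.
    move: fg; apply: filterS => x fx _.
    have fmx : `|f n x - f m x| @[n --> \oo] --> `|g x - f m x|.
      by apply: cvg_norm; apply: cvgB => //; exact: cvg_cst.
    have [gm0|gm0] := eqVneq (g x - f m x) 0.
      rewrite gm0.
      by rewrite abse0 poweR_EFin powR0 ?gt_eqF//; exact: limn_einf_ge0.
    rewrite le_eqVlt; apply/orP; left; apply/eqP/esym.
    apply: (cvg_limn_einf_sup _).1.
    rewrite abse_EFin poweR_EFin.
    under eq_fun do rewrite abse_EFin poweR_EFin.
    apply: cvg_EFin; first exact: nearW.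
    apply: (@continuous_cvg _ _ _ _ _ _ (fun t => t `^ r) _ _ fmx).
    by apply: powR_continuous; rewrite normr_gt0.
  apply: (le_trans (fatou mu measurableT mff (fun n x _ => h0 n x))).
  apply: (@limn_einf_le _ _ m) => n mn.
  rewrite -(@powR_Lnorm _ _ _ mu (EFin \o (f n - f m))) ?gt_eqF//.
  rewrite -finite_norm_fine !poweR_EFin lee_fin.
  apply: ge0_ler_powR; [exact: ltW| | |exact: f_cauchy].
  - by rewrite nnegrE fine_ge0// Lnorm_ge0.
  - by rewrite nnegrE.
have gf0 : (g - f 0%N : T -> R) \in Lfun mu r%:E.
  apply/andP; split; rewrite inE/=; first exact: measurable_funB.
  by apply: le_lt_trans (g_close 0%N) _; exact: ltry.
have gL : g \in Lfun mu r%:E.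
  have -> : g = (g - f 0%N) + f 0%N :> (T -> R) by rewrite subrK.
  by rewrite rpredD//; exact: LfunP.
exists (Lfun_Sub r1 gL) => m.
by rewrite -lee_fin finite_norm_fine; exact: g_close.
Qed.

Lemma Lspace_cauchy_cvg (F : set_system LT) :
  ProperFilter F -> cauchy F -> cvg F.
Proof.
move=> FF /cauchyP F_cauchy.
pose e k : R := 2^-1 * 4^-1 ^+ k.
have e0 k : 0 < e k by rewrite mulr_gt0// exprn_gt0.
have [u uF] : {u : nat -> LT & forall k, F (ball (u k) (e k))}.
  apply: (@boolp.choice _ _ (fun k x => F (ball x (e k)))) => k.
  by have [x Fx] := F_cauchy _ (e0 k); exists x.
have u_cauchy m n : (m <= n)%N -> `|u n - u m| <= 4^-1 ^+ m.
  move=> mn; have [z []] := filter_ex (filterI (uF n) (uF m)).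
  rewrite -ball_normE/= => zn zm.
  have -> : u n - u m = (u n - z) - (u m - z) by rewrite opprB addrA subrK.
  apply: (le_trans (ler_normB _ _)).
  apply: (@le_trans _ _ (e n + e m)); first by apply: lerD; exact: ltW.
  have : e n <= e m.
    by rewrite ler_pM2l// ler_wiXn2l// ?invr_ge0// invf_le1// ler1n.
  rewrite /e; lra.
have [g gu] : exists g : LT, forall m, `|g - u m| <= 4^-1 ^+ m.
  have [|g gu] := @Lfun_cauchy_limit (fun k => Lrepr (u k)).
    move=> m n mn; rewrite -Lspace_normE LclassD LclassN !LreprK.
    exact: u_cauchy.
  exists (Lclass g) => m.
  by have := gu m; rewrite -Lspace_normE LclassD LclassN LreprK.
apply/cvg_ex; exists g; apply/cvgrPdist_le => /= eps eps0.
have [k ke] : exists k, 2 * 4^-1 ^+ k <= eps.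
  have /cvgr0Pnorm_le : (fun k => 4^-1 ^+ k : R) @ \oo --> 0.
    by apply: cvg_expr; rewrite ger0_norm//; lra.
  move=> /(_ (eps / 2)) /=; rewrite divr_gt0// => /(_ isT) /filter_ex[k].
  by rewrite ger0_norm ?exprn_ge0// => ke; exists k; lra.
apply: filterS (uF k) => x; rewrite -ball_normE/= => ux.
have -> : g - x = (g - u k) + (u k - x) by rewrite addrA subrK.
apply: (le_trans (ler_normD _ _)).
have := gu k; move: ux; rewrite /e; have : 0 <= 4^-1 ^+ k :> R by rewrite exprn_ge0.
lra.
Qed.

HB.instance Definition _ := Uniform_isComplete.Build LT Lspace_cauchy_cvg.

End Lspace_complete.

(* Main.v *)
Require Import Defs.
From mathcomp Require Import all_boot all_order all_algebra.
From mathcomp Require Import all_classical all_reals all_analysis.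
From mathcomp Require Import measurable_realfun.
From mathcomp Require Import ring lra.
Import Order.TTheory GRing.Theory Num.Theory.
Import numFieldNormedType.Exports.
Local Open Scope classical_set_scope.
Local Open Scope ring_scope.
Set Implicit Arguments.
Unset Strict Implicit.

(* If [z n] lies in [Dset x (- x) (e n)] with [e n] tending to 0, then local
   uniform convexity forces [z n - x] to converge to [x]; hence a closed set
   meeting every member of [Dfamily] contains [2 *: x] for each unit vector
   [x], and balancedness gives the ball of radius 2.

   For [L^p], a pointwise inequality
     [|a - b|^p + C |(a + b)/2|^p <= (C/2 + s^p) (|a|^p + |b|^p)],
   with [s] arbitrarily small and [C] depending on [s], integrates to the same
   inequality between norms. When [|f| <= 1], [|g| = 1] and [|f + g|] is close
   to 2 it bounds [|f - g|^p] by about [2 s^p]. *)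

(** * The USD-parameter of locally uniformly convex spaces *)

Lemma luc_double_sphere_subset (R : realType) (E : completeNormedModType R)
    (A : set E) (x : E) :
  locally_uniformly_convex E -> closed A ->
  (forall D, Dfamily D -> A `&` D !=set0) -> unit_sphere x -> A (2 *: x).
Proof.
move=> luc cA AD x1.
pose e (n : nat) : R := harmonic n.
have e_gt0 n : 0 < e n by rewrite /e /= invr_gt0.
have e_cvg0 : e n @[n --> \oo] --> (0 : R) by exact: cvg_harmonic.
have [z zP] : {z : nat -> E & forall n, (A `&` Dset x (- x) (e n)) (z n)}.
  apply: (@boolp.choice _ _ (fun n z => (A `&` Dset x (- x) (e n)) z)) => n.
  apply: AD; exists x, (- x), (e n); split => //.
  by rewrite /unit_sphere/= normrN.
(* Local uniform convexity concerns the unit ball, but [w n] only has norm below [1 + e n]; hence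
   the rescaled [v n]. *)
pose w n := - x + z n.
pose v n := (1 + e n)^-1 *: w n.
have w_lt n : `|w n| < 1 + e n by have [_ []] := zP n.
have z_gt n : 2 - e n < `|w n + x|.
  have -> : w n + x = z n by rewrite /w addrC addrA subrr add0r.
  by have [_ [+ _]] := zP n; rewrite subrr add0r.
(* The rescaling moves [w n] by at most [e n], and [w n + x = z n] has norm above [2 - e n], so
   [v n + x] has norm at least [2 - 2 * e n]. *)
have vE n : v n = w n - (e n / (1 + e n)) *: w n.
  rewrite /v -[in RHS](scale1r (w n)) scalerA mulr1 -scalerBl; congr (_ *: _).
  by field; rewrite gt_eqF// addr_gt0.
have v_le1 n : `|v n| <= 1.
  have e1 : 0 < 1 + e n by rewrite addr_gt0.
  rewrite /v normrZ gtr0_norm ?invr_gt0// mulrC ler_pdivrMr// mul1r.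
  exact: ltW.
have vx_cvg : `|v n + x| @[n --> \oo] --> (2 : R).
  apply: (@squeeze_cvgr _ _ _ _ (fun n => 2 - 2 * e n) (fun=> 2)).
  - near=> n; apply/andP; split; last first.
      by apply: (le_trans (ler_normD _ _)); rewrite x1 (natrD _ 1 1) lerD2r.
    rewrite vE [X in `|X|]addrAC; apply: le_trans (lerB_dist _ _).
    have : `|(e n / (1 + e n)) *: w n| <= e n.
      have e1 : 0 < 1 + e n by rewrite addr_gt0.
      rewrite normrZ gtr0_norm ?divr_gt0// mulrAC ler_pdivrMr//.
      by rewrite ler_pM2l// ltW.
    have := z_gt n; lra.
  - rewrite -[X in _ --> X]subr0 -[X in _ - X](mulr0 2).
    by apply: cvgB; [exact: cvg_cst|apply: cvgM => //; exact: cvg_cst].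
  - exact: cvg_cst.
have v_cvg := luc x x1 v v_le1 vx_cvg.
apply: (closed_cvg A cA (u_ := z) (F := \oo)).
  by apply: nearW => n; have [] := zP n.
have -> : z = (fun n => x + (1 + e n) *: v n).
  apply/funext => n; rewrite /v scalerA divff ?gt_eqF ?addr_gt0//.
  by rewrite scale1r /w addrA subrr add0r.
rewrite scaler_nat mulr2n; apply: cvgD; first exact: cvg_cst.
rewrite -[X in _ --> X]scale1r; apply: cvgZ => //.
by rewrite -[X in _ --> X]addr0; apply: cvgD => //; exact: cvg_cst.
Unshelve. all: by end_near. Qed.

Lemma luc_USD_admissible (R : realType) (E : completeNormedModType R) :
  locally_uniformly_convex E -> USD_admissible E 2.
Proof.
move=> luc; split=> // A cA [[a Aa] _ balA] AD _ [z z1 <-].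
have [->|z0] := eqVneq z 0.
  by rewrite scaler0 -(scale0r a); apply: balA; rewrite ?normr0.
have nz : 0 < `|z| by rewrite normr_gt0.
(* The doubled unit vector in the direction of [z] lies in [A], and the factor [|z|] is at most
   1. *)
have -> : 2 *: z = `|z| *: (2 *: (`|z|^-1 *: z)).
  by rewrite !scalerA mulrCA mulrA mulfK ?gt_eqF.
apply: balA; first by rewrite normr_id.
apply: luc_double_sphere_subset => //.
by rewrite /unit_sphere/= normrZ normfV normr_id mulVf ?gt_eqF.
Qed.

(* [x - y] lies in [Dset x y eps], so the ball of radius 2 is a test set. *)
Lemma USD_admissible_le2 (R : realType) (E : completeNormedModType R)
    (beta : R) :
  (exists x : E, x != 0) -> USD_admissible E beta -> beta <= 2.
Proof.
move=> [u u0] [beta0 adm].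
pose x := `|u|^-1 *: u.
have x1 : `|x| = 1 by rewrite normrZ normfV normr_id mulVf ?normr_eq0.
have /adm : closed [set z : E | `|z| <= 2].
  have -> : [set z : E | `|z| <= 2] = closed_ball_ Num.norm (0 : E) 2.
    by apply/seteqP; split => z; rewrite /closed_ball_/= sub0r normrN.
  exact: closed_closed_ball_.
have H1 : absolutely_convex [set z : E | `|z| <= 2].
  split.
  - by exists 0; rewrite /= normr0.
  - move=> y z l; rewrite !inE/= => y2 z2.
    have l0 : 0 <= l%:num :> R by [].
    have l1 : 0 <= 1 - l%:num :> R by rewrite subr_ge0.
    apply: (le_trans (ler_normD _ _)); rewrite !normrZ /unstable.onem.
    rewrite (ger0_norm l0) (ger0_norm l1).
    have := ler_wpM2l l0 y2; have := ler_wpM2l l1 z2; lra.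
  - move=> a y a1 /= y2; rewrite normrZ -(mul1r 2).
    exact: ler_pM.
move=> /(_ H1) sub.
have : [set z : E | `|z| <= 2] (beta *: x).
  apply: sub; last by exists x => //=; rewrite /unit_ball/= x1.
  move=> _ [y [z [eps [y1 z1 eps0 ->]]]]; exists (y - z); split => /=.
    by apply: (le_trans (ler_normB _ _)); rewrite y1 z1.
  rewrite /Dset /=.
  have -> : y + z + (y - z) = y *+ 2 by rewrite addrACA subrr addr0.
  have -> : z + (y - z) = y by rewrite addrC subrK.
  by rewrite normrMn y1; split; lra.
by rewrite /= normrZ x1 mulr1 gtr0_norm.
Qed.

(** * Scalar inequalities for [p]-th powers *)

(** The convexity gap of the power function between 1 and [t] has derivative [p / 2] times the
    difference of the [(p - 1)]-th powers of [t] and [(1 + t) / 2], which is negative for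
    [0 < t < 1]. *)
Lemma powR_midpoint_gap_lt (R : realType) (p v w : R) : 1 < p ->
  0 < v -> v < w -> w <= 1 ->
  (1 + w `^ p) / 2 - ((1 + w) / 2) `^ p < (1 + v `^ p) / 2 - ((1 + v) / 2) `^ p.
Proof.
move=> p1 v0 vw w1.
pose g (t : R) : R := 2^-1 * (1 + t `^ p) - (2^-1 * (1 + t)) `^ p.
have dg (t : R) : 0 < t -> is_derive t 1 g
    (2^-1 * (p * t `^ (p - 1)) - (p * (2^-1 * (1 + t)) `^ (p - 1)) * 2^-1).
  move=> t0.
  have h0 : 0 < 2^-1 * (1 + t) by lra.
  have d1 := is_derive1_powR p t0.
  have d2 := is_derive1_powR p h0.
  have d3 : is_derive t 1 (fun t : R => 2^-1 * (1 + t)) 2^-1.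
    apply: is_derive_eq; rewrite /GRing.scale/=; lra.
  have d4 := is_derive1_comp (f := @powR R ^~ p)
    (g := fun t => 2^-1 * (1 + t)) d2 d3.
  apply: is_deriveB.
  apply: is_derive_eq; rewrite /GRing.scale/=; lra.
have gE t : (1 + t `^ p) / 2 - ((1 + t) / 2) `^ p = g t.
  by rewrite /g ![2^-1 * _]mulrC.
rewrite !gE.
apply: (@ltr0_derive1_lt_oc R g 0 1) => //; rewrite ?in_itv/=.
- by move=> x; rewrite in_itv/= => /andP[x0 _]; have [] := dg _ x0.
- move=> x; rewrite in_itv/= => /andP[x0 x1]; rewrite derive1E.
  have [_ ->] := dg _ x0.
  have : x `^ (p - 1) < (2^-1 * (1 + x)) `^ (p - 1).
    by apply: gt0_ltr_powR; rewrite ?nnegrE; lra.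
  rewrite -(ltr_pM2l (x := p)); lra.
- apply: derivable_within_continuous => x; rewrite in_itv/= => /andP[x0 _].
  by have [] := dg _ x0.
- lra.
- lra.
Qed.

Lemma powR_midpoint_gap (R : realType) (p s : R) : 1 < p -> 0 < s < 1 ->
  exists2 m, 0 < m & forall t, -1 <= t <= 1 - s ->
    m <= (1 + `|t| `^ p) / 2 - (`|1 + t| / 2) `^ p.
Proof.
move=> p1 /andP[s0 s1].
pose g (t : R) : R := (1 + t `^ p) / 2 - ((1 + t) / 2) `^ p.
have g1 : g 1 = 0 by rewrite /g (_ : (1 + 1) / 2 = 1) ?powR1; lra.
have gs : 0 < g (1 - s) by rewrite -g1; apply: powR_midpoint_gap_lt; lra.
have half : 2^-1 `^ p < 2^-1 :> R.
  rewrite -[X in _ < X]powRr1; last lra.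
  rewrite /powR gt_eqF ?invr_gt0// ltr_expR ltr_nM2r//.
  by rewrite ln_lt0// invr_gt0 invf_lt1//; lra.
exists (Num.min (2^-1 - 2^-1 `^ p) (g (1 - s))).
  by rewrite lt_min gs andbT; lra.
move=> t /andP[t1 ts]; rewrite ge_min.
have [t0|t0] := leP t 0; apply/orP.
  left.
  have : (`|1 + t| / 2) `^ p <= 2^-1 `^ p.
    rewrite ger0_norm; last lra.
    by apply: ge0_ler_powR; rewrite ?nnegrE; lra.
  have := powR_ge0 `|t| p; lra.
right; rewrite !ger0_norm; [|lra..].
have [->//|tN] := eqVneq t (1 - s).
by apply/ltW/powR_midpoint_gap_lt; rewrite ?lt_neqAle ?tN; lra.
Qed.

Lemma powR_midpoint_gap_ge0 (R : realType) (p t : R) : 1 < p -> -1 <= t <= 1 ->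
  (`|1 + t| / 2) `^ p <= (1 + `|t| `^ p) / 2.
Proof.
move=> p1 /andP[t1]; rewrite le_eqVlt => /predU1P[->|t2].
  by rewrite !ger0_norm// (_ : (1 + 1) / 2 = 1) ?powR1; lra.
(* For [-1 <= t < 1], the number [(1 - t) / 4] lies strictly between 0 and 1 and is small enough to
   put [t] in the range of the gap bound. *)
have [|m m0 /(_ t)] := @powR_midpoint_gap R p ((1 - t) / 4) p1; first lra.
have -> : -1 <= t <= 1 - (1 - t) / 4 by lra.
by move=> /(_ isT); lra.
Qed.

Lemma powR_uniform_convex (R : realType) (p s : R) : 1 < p -> 0 < s < 1 ->
  exists2 C, 0 < C & forall a b,
    `|a - b| `^ p + C * `|2^-1 * (a + b)| `^ p <=
    (C / 2 + s `^ p) * (`|a| `^ p + `|b| `^ p).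
Proof.
move=> p1 s01; have [m m0 mP] := powR_midpoint_gap p1 s01.
have p0 : 0 <= p by lra.
have [s0 s1] := andP s01.
pose C := 2 `^ p / m.
have C0 : 0 < C by rewrite divr_gt0// powR_gt0.
have sp0 : 0 <= s `^ p := powR_ge0 s p.
have unit_case t : -1 <= t <= 1 ->
    `|1 - t| `^ p + C * (`|1 + t| / 2) `^ p <=
    (C / 2 + s `^ p) * (1 + `|t| `^ p).
  move=> t11; have tp := powR_ge0 `|t| p.
  have st : 0 <= s `^ p * `|t| `^ p by rewrite mulr_ge0.
  have [ts|ts] := leP t (1 - s).
    have : C * m <= C * ((1 + `|t| `^ p) / 2 - (`|1 + t| / 2) `^ p).
      by rewrite ler_pM2l//; apply: mP; lra.
    rewrite {1}/C divfK ?gt_eqF//.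
    have : `|1 - t| `^ p <= 2 `^ p.
      by apply: ge0_ler_powR; rewrite ?nnegrE// ger0_norm; lra.
    lra.
  have : `|1 - t| `^ p <= s `^ p.
    by apply: ge0_ler_powR; rewrite ?nnegrE// ?ger0_norm; lra.
  have := powR_midpoint_gap_ge0 p1 t11.
  rewrite -(ler_pM2l C0); lra.
exists C => // a b.
(* By symmetry the ratio [b / a] may be taken in [-1, 1]; homogeneity of degree [p] then reduces the
   claim to [unit_case]. *)
wlog ba : a b / `|b| <= `|a|.
  move=> H; have [/H//|/ltW/H] := leP `|b| `|a|.
  by rewrite distrC (addrC b) [X in _ <= _ * X]addrC.
have [a0|a0] := eqVneq a 0.
  move: ba; rewrite a0 normr0 normr_le0 => /eqP ->.
  by rewrite subrr addr0 mulr0 normr0 powR0 ?gt_eqF ?mulr0 ?addr0 ?mulr0//; lra.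
pose t := b / a.
have bE : b = a * t by rewrite /t mulrC divfK.
have t1 : -1 <= t <= 1.
  by rewrite -ler_norml normrM normfV ler_pdivrMr ?normr_gt0// mul1r.
have -> : a - b = a * (1 - t) by rewrite bE; ring.
have -> : 2^-1 * (a + b) = a * ((1 + t) / 2) by rewrite bE; ring.
have -> : `|b| = `|a| * `|t| by rewrite bE normrM.
have n2 : `|(1 + t) / 2| = `|1 + t| / 2.
  by rewrite normrM (ger0_norm (x := 2^-1)).
rewrite !(normrM a) n2 !(powRM _ (normr_ge0 a)) ?divr_ge0//.
have := unit_case t t1.
rewrite -(ler_pM2l (x := `|a| `^ p)) ?powR_gt0 ?normr_gt0//; lra.
Qed.

(** * Local uniform convexity of L^p *)

Section Lspace_uniform_convexity.
Context d (T : measurableType d) (R : realType).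
Variable mu : {measure set T -> \bar R}.
Variables (p : R) (p1 : (1 <= p%:E)%E).
Local Notation LT := (LspaceType mu p1).

Let p_ge1 : 1 <= p. Proof. by rewrite -lee_fin. Qed.
Let p_neq0 : p != 0. Proof. by rewrite gt_eqF// (lt_le_trans ltr01). Qed.

Lemma Lspace_norm_powR (f : LfunType mu p1) :
  ((`|Lclass f : LT| `^ p)%:E = \int[mu]_x (`|f x| `^ p)%:E)%E.
Proof.
by rewrite [`|_|]Lspace_normE -poweR_EFin finite_norm_fine powR_Lnorm.
Qed.

Lemma Lspace_norm_uniform_convex (s : R) : 1 < p -> 0 < s < 1 ->
  exists2 C, 0 < C & forall f g : LT,
    `|f - g| `^ p + C * `|2^-1 *: (f + g)| `^ p <=
    (C / 2 + s `^ p) * (`|f| `^ p + `|g| `^ p).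
Proof.
move=> p_gt1 s01; have [C C0 CP] := @powR_uniform_convex R p s p_gt1 s01.
exists C => // f g; rewrite -(LreprK f) -(LreprK g).
move: (Lrepr f) (Lrepr g) => {}f {}g.
have K0 : 0 <= C / 2 + s `^ p by rewrite addr_ge0 ?powR_ge0// divr_ge0// ltW.
have mpow (h : LfunType mu p1) :
    measurable_fun [set: T] (fun x => (`|h x| `^ p)%:E).
  apply/measurable_EFinP; apply: (measurableT_comp (measurable_powR p)).
  by apply: measurableT_comp => //; exact: measurable_funPT.
rewrite -LclassN -!LclassD -LclassZ.
(* Powers of norms become integrals of nonnegative functions; linearity gathers each side into one
   integral, and the integrands are compared pointwise. *)
rewrite -lee_fin EFinM !EFinD EFinM !Lspace_norm_powR.
rewrite -!ge0_integralZl//; [|exact/ltW|..]; last first.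
rewrite -!ge0_integralD//; last 2 first.
- by move=> x _; rewrite -EFinM lee_fin mulr_ge0 ?powR_ge0// ltW.
- by apply: measurable_funeM.
rewrite -EFinD -ge0_integralZl//; last 2 first.
- exact: emeasurable_funD.
- by move=> x _; rewrite -EFinD lee_fin addr_ge0 ?powR_ge0.
apply: ge0_le_integral => //.
- move=> x _; rewrite -EFinM -EFinD lee_fin addr_ge0 ?mulr_ge0 ?powR_ge0//.
  exact: ltW.
- by apply: emeasurable_funD => //; exact: measurable_funeM.
- by apply: measurable_funeM; exact: emeasurable_funD.
- by move=> x _; rewrite -EFinM -!EFinD -EFinM lee_fin; exact: CP.
Qed.

Lemma Lspace_locally_uniformly_convex : 1 < p -> locally_uniformly_convex LT.
Proof.
move=> p_gt1 x0 x01 x x1 xx0; apply/cvgrPdist_lt => e e0.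
(* With [4 * s <= e], a distance of at least [e] would have [p]-th power at least [4 * s]^
   p[, against the bound]3 * s [^ p] obtained below. *)
pose s := Num.min (e / 4) 2^-1.
have s0 : 0 < s by rewrite lt_min divr_gt0/=.
have s1 : s < 1 by rewrite gt_min; apply/orP; right; lra.
have se : s <= e / 4 by rewrite ge_min lexx.
have [|C C0 CP] := @Lspace_norm_uniform_convex s p_gt1; first exact/andP.
have sp0 : 0 < s `^ p by exact: powR_gt0.
have p0 : 0 < p by lra.
have pow_cvg : (2^-1 * `|x n + x0|) `^ p @[n --> \oo] --> (1 : R).
  have h : 2^-1 * `|x n + x0| @[n --> \oo] --> (1 : R).
    rewrite -[X in _ --> X](@mulVf R 2)//.
    by apply: cvgM => //; exact: cvg_cst.
  rewrite -[X in _ --> X](congr1 (fun f => f p) (powR1 R)).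
  apply: (@continuous_cvg _ _ _ _ _ _ (fun t : R => t `^ p) _ _ h).
  apply/differentiable_continuous/derivable1_diffP.
  by have [] := is_derive1_powR p ltr01.
have le1 (t : R) : 0 <= t -> t <= 1 -> t `^ p <= 1.
  move=> t0 t1; rewrite -[leRHS](congr1 (fun f => f p) (powR1 R)).
  by apply: ge0_ler_powR; rewrite ?nnegrE// ltW.
(* The tolerance [s]^ p / C[costs one]s [^ p] after multiplication by [C]; the two others come from
   the two vectors of norm at most 1. *)
have /cvgrPdist_lt /(_ _ (divr_gt0 sp0 C0)) := pow_cvg.
apply: filterS => n; rewrite ltr_norml => /andP[_].
rewrite ltr_pdivlMr// => near1.
have := CP (x n) x0; rewrite normrZ ger0_norm// => ucn.
have xn1 := le1 _ (normr_ge0 _) (x1 n).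
have x0p : `|x0| `^ p = 1 by rewrite x01 powR1.
have dist_pow : `|x n - x0| `^ p < 3 * s `^ p.
  have : (C / 2 + s `^ p) * `|x n| `^ p <= (C / 2 + s `^ p) * 1.
    by rewrite ler_wpM2l// addr_ge0 ?divr_ge0// ltW.
  rewrite x0p in ucn; lra.
rewrite distrC ltNge; apply/negP => en.
have : (4 * s) `^ p <= `|x n - x0| `^ p.
  by apply: ge0_ler_powR; rewrite ?nnegrE//; lra.
rewrite powRM//; last exact: ltW.
have : 4 * s `^ p <= 4 `^ p * s `^ p.
  by rewrite ler_pM2r// le1r_powR//; lra.
lra.
Qed.

End Lspace_uniform_convexity.

(** In the zero space every positive number is admissible, so a largest one exists only in the
    presence of a nonzero vector. *)
Theorem corollary2p6 (R : realType) :
  (forall E : completeNormedModType R,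
     (exists x : E, x != 0) ->
     locally_uniformly_convex E ->
     USD_nonfriendly E /\ is_USD_parameter E 2) /\
  (forall (d : measure_display) (T : measurableType d)
     (mu : {measure set T -> \bar R}) (p : R) (p1 : (1 <= p%:E)%E),
     1 < p -> USD_nonfriendly (LspaceType mu p1)).
Proof.
split=> [E E0 luc|d T mu p p1 p_gt1].
  have adm := luc_USD_admissible luc.
  by split; [exists 2|split=> // beta; exact: USD_admissible_le2].
by exists 2; apply: luc_USD_admissible; exact: Lspace_locally_uniformly_convex.
Qed.
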